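(* Let $n\ge 2$ and let $\alpha=(\alpha_0,\dots,\alpha_{n-1})$, $\beta=(\beta_0,\dots,\beta_{n-1})$, $\gamma=(\gamma_0,\dots,\gamma_{n-1})$ be (arbitrarily ordered) $n$-tuples of nonzero real numbers with $\prod_i\alpha_i\gamma_i=\prod_i\beta_i$. Assume that either $n$ is odd and all $\alpha_i,\beta_i,\gamma_i$ are positive, or $n$ is even, all $\alpha_i,\beta_i$ are positive and all $\gamma_i$ are negative. With the notation of the context, let $\Omega^+_{0,3,n}(\alpha,\beta,\gamma)\subset\Omega_{0,3,n}(\alpha,\beta,\gamma)$ be the set of classes $[(A,B)]$ of the pairs of matrices associated to $\mathbb C^*$-connections on $\mathcal G_n$ all of whose face weights $X_{ij}$ are positive reals and whose zig-zag monodromies are $z^{NE}_i=\alpha_i$, $z^{SE}_j=\beta_j$, $z^{S}_c=(-1)^{n+1}\gamma_c$ for $0\le i,j,c\le n-1$. Then for each $Y=(Y_{ij})_{0\le i\le n-3,\,0\le j\le n-2}\in(\mathbb R_+)^{(n-1)(n-2)}$ there is a unique such connection up to gauge with $X_{ij}=Y_{ij}$ for $0\le i\le n-3$, $0\le j\le n-2$, and the resulting map $$\Psi:(\mathbb R_+)^{(n-1)(n-2)}\to\Omega^+_{0,3,n}(\alpha,\beta,\gamma),\qquad Y\mapsto[(A,B)],$$ is onto and is a positive Laurent parameterization: the edge weights can be chosen so that every entry of $A$ and of $B$ is a sum, with coefficients $1$, of Laurent monomials in the $Y_{ij}$, $\alpha_i$, $\beta_i$ and $(-1)^{n+1}\g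amma_i$.
   Context: $\mathbb R_+$ denotes the positive reals. $\Omega_{0,3,n}(\alpha,\beta,\gamma)$ is the space of pairs $(A,B)\in\mathrm{GL}_n(\mathbb C)^2$, up to simultaneous conjugation, such that $A$, $B$, $BA^{-1}$ have eigenvalues $\alpha,\beta,\gamma$ respectively (with multiplicity). The torus honeycomb graph $\mathcal G_n$. It has black vertices $\mathsf b_{ij}$ and white vertices $\mathsf w_{ij}$, $i,j\in\mathbb Z/n$. From each black vertex $\mathsf b_{ij}$ there are three edges: a horizontal edge to $\mathsf w_{ij}$, a north-east (NE) edge to $\mathsf w_{i,j+1}$, and a south-east (SE) edge to $\mathsf w_{i+1,j}$. It is drawn on a torus with $n^2$ hexagonal faces; the face $f_{ij}$ has vertices $\mathsf b_{ij},\mathsf w_{i+1,j},\mathsf b_{i+1,j},\mathsf w_{i+1,j+1},\mathsf b_{i,j+1},\mathsf w_{i,j+1}$ in counterclockwise order. A $\mathbb C^*$-connection assigns to each edge a nonzero scalar (its weight) for the black-to-white direction, and the inverse scalar for the reverse direction; the weight (monodromy) of a (closed) path is the product of the scalars along it. A gauge transformation multiplies the weights of all edges at a given vertex by a common nonzero scalar; connections are considered up to gauge. Every connection is gauge equivalent to one with horizontal weights $1$; we then write $a_{ij}$ and $b_{ij}$ for the weights of the NE and SE edges out of $\mathsf b_{ij}$. Face weights (counterclockwise monodromy around $f_{ij}$): $X_{ij}=\dfrac{b_{ij}\,a_{i+1,j}}{a_{ij}\,b_{i,j+1}}$. Zig-zag monodromies: $z^{NE}_i=\prod_{j} a_{ij}$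 (north-east zig-zags), $z^{SE}_j=\prod_i b_{ij}$ (south-east zig-zags), $z^S_c=\prod_{i+j\equiv c \bmod n} b_{ij}/a_{ij}$ (south zig-zags). The matrices $A$ and $B$ (rows and columns indexed by $0,\dots,n-1$). Consider lattice paths of exactly $n$ steps in which from position $(i,j)$ one moves either to $(i,j+1)$ (NE step, weight $a_{ij}$) or to $(i+1,j)$ (SE step, weight $b_{ij}$), where $a,b$ are extended $n$-periodically in both indices; the weight of a path is the product of the weights of its steps. $A_{i'i}$ is the sum of the weights of all such paths starting at $(i,n-1-i)$, ending in row $i'$ (first coordinate $i'$), so that the first coordinate is at most $n-1$ throughout. $B_{i'i}$ is the sum of the weights of all such paths starting at $(i,n-1-i)$ and ending in column $n-1-i'$ (second coordinate $n-1-i'$), so that the second coordinate is at most $n-1$ throughout. (A gauge transformation keeping horizontal weights $1$ conjugates $A$ and $B$ simultaneously by a diagonal matrix. Whenever the zig-zag monodromies are as prescribed in the claim, $A$, $B$, $BA^{-1}$ have eigenvalues $\alpha$, $\beta$, $\gamma$.) *)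

(* Defs.v *)
From HB Require Import structures.
From mathcomp Require Import all_boot all_order all_algebra.
From mathcomp Require Import complex.
From mathcomp Require Import classical_sets functions reals.

Set Implicit Arguments.
Unset Strict Implicit.
Unset Printing Implicit Defensive.

Import Order.TTheory GRing.Theory Num.Theory.
Local Open Scope classical_set_scope.
Local Open Scope ring_scope.
Local Open Scope complex_scope.

(* All definitions are meant for n >= 2, the range in which 'Z_n is Z/n. *)

(* A C^*-connection on the honeycomb graph: hor i j, ne i j and se i j are the
   weights, in the black-to-white direction, of the edges from b_{ij} to
   w_{i,j}, w_{i,j+1} and w_{i+1,j}. *)
Record connection (R : realType) (n : nat) := Connection {
  hor : 'Z_n -> 'Z_n -> R[i];
  ne : 'Z_n -> 'Z_n -> R[i];
  se : 'Z_n -> 'Z_n -> R[i];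
  hor_neq0 : forall i j, hor i j != 0;
  ne_neq0 : forall i j, ne i j != 0;
  se_neq0 : forall i j, se i j != 0
}.

(* gb i j and gw i j are the scalars at the vertices b_{ij} and w_{ij}. *)
Definition gauge_equiv (R : realType) (n : nat) (c c' : connection R n) : Prop :=
  exists gb gw : 'Z_n -> 'Z_n -> R[i],
    (forall i j, gb i j != 0 /\ gw i j != 0) /\
    (forall i j, [/\ hor c' i j = gb i j * gw i j * hor c i j,
                     ne c' i j = gb i j * gw i (j + 1) * ne c i j
                   & se c' i j = gb i j * gw (i + 1) j * se c i j]).

Definition horizontal1 (R : realType) (n : nat) (c : connection R n) : Prop :=
  forall i j, hor c i j = 1.

(* Monodromy along b_{ij}, w_{i+1,j}, b_{i+1,j}, w_{i+1,j+1}, b_{i,j+1},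
   w_{i,j+1}, b_{ij}; edges run from white to black contribute inverses. *)
Definition face_weight (R : realType) (n : nat) (c : connection R n)
    (i j : 'Z_n) : R[i] :=
  se c i j * (hor c (i + 1) j)^-1 * ne c (i + 1) j *
  (se c i (j + 1))^-1 * hor c i (j + 1) * (ne c i j)^-1.

(* The NE and SE zig-zags run through the horizontal edges from white to black;
   the south zig-zags avoid the horizontal edges. *)
Definition zigzagNE (R : realType) (n : nat) (c : connection R n)
    (i : 'Z_n) : R[i] :=
  \prod_(j : 'Z_n) (ne c i j / hor c i j).

Definition zigzagSE (R : realType) (n : nat) (c : connection R n)
    (j : 'Z_n) : R[i] :=
  \prod_(i : 'Z_n) (se c i j / hor c i j).

Definition zigzagS (R : realType) (n : nat) (c : connection R n)
    (k : 'Z_n) : R[i] :=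
  \prod_(i : 'Z_n) \prod_(j : 'Z_n | i + j == k) (se c i j / ne c i j).

(* A lattice path is a sequence of steps, true being SE and false being NE;
   positions are in nat * nat and the cast _%:R to 'Z_n makes the weights
   n-periodic. *)
Fixpoint path_end (i j : nat) (s : seq bool) : nat * nat :=
  match s with
  | [::] => (i, j)
  | true :: s' => path_end i.+1 j s'
  | false :: s' => path_end i j.+1 s'
  end.

Fixpoint path_weight (R : realType) (n : nat) (c : connection R n)
    (i j : nat) (s : seq bool) : R[i] :=
  match s with
  | [::] => 1
  | true :: s' => se c i%:R j%:R * path_weight c i.+1 j s'
  | false :: s' => ne c i%:R j%:R * path_weight c i j.+1 s'
  end.

(* The matrices A and B of a connection with horizontal weights 1. Coordinates
   never decrease along a path, so the condition on the endpoint bounds the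
   coordinate throughout. *)
Definition matA (R : realType) (n : nat) (c : connection R n) : 'M[R[i]]_n :=
  \matrix_(i', i)
    \sum_(s : n.-tuple bool | (path_end i (n - 1 - i) s).1 == i')
      path_weight c i (n - 1 - i) s.

Definition matB (R : realType) (n : nat) (c : connection R n) : 'M[R[i]]_n :=
  \matrix_(i', i)
    \sum_(s : n.-tuple bool | (path_end i (n - 1 - i) s).2 == (n - 1 - i')%N)
      path_weight c i (n - 1 - i) s.

(* The class [(A, B)] under simultaneous conjugation. *)
Definition conj_class (R : realType) (n : nat) (A B : 'M[R[i]]_n) :
    set ('M[R[i]]_n * 'M[R[i]]_n) :=
  [set q | exists2 P : 'M[R[i]]_n, P \in unitmx &
     q = (P *m A *m invmx P, P *m B *m invmx P)].

Definition has_eigenvalues (R : realType) (n : nat) (A : 'M[R[i]]_n)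
    (lambda : 'I_n -> R[i]) : Prop :=
  char_poly A = \prod_(i < n) ('X - (lambda i)%:P).

Definition Omega (R : realType) (n : nat) (alpha beta gamma : 'I_n -> R[i]) :
    set (set ('M[R[i]]_n * 'M[R[i]]_n)) :=
  [set w | exists A B : 'M[R[i]]_n,
     [/\ A \in unitmx /\ B \in unitmx,
         has_eigenvalues A alpha, has_eigenvalues B beta,
         has_eigenvalues (B *m invmx A) gamma
       & w = conj_class A B]].

(* In R[i] with its partial order, 0 < x means that x is a positive real. *)
Definition positive_prescribed (R : realType) (n : nat)
    (alpha beta gamma : 'I_n -> R) (c : connection R n) : Prop :=
  (forall i j, 0 < face_weight c i j) /\
  (forall k : 'I_n, [/\ zigzagNE c k%:R = (alpha k)%:C,
                        zigzagSE c k%:R = (beta k)%:C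
                      & zigzagS c k%:R = ((-1) ^+ n.+1 * gamma k)%:C]).

Definition OmegaPlus (R : realType) (n : nat) (alpha beta gamma : 'I_n -> R) :
    set (set ('M[R[i]]_n * 'M[R[i]]_n)) :=
  [set w | exists c : connection R n,
     [/\ horizontal1 c, positive_prescribed alpha beta gamma c
       & w = conj_class (matA c) (matB c)]].

Definition face_coordinates (R : realType) (n : nat)
    (Y : 'M[R]_(n - 2, n - 1)) (c : connection R n) : Prop :=
  forall (i : 'I_(n - 2)) (j : 'I_(n - 1)),
    face_weight c i%:R j%:R = (Y i j)%:C.

Definition positive_entries (R : realType) (m n : nat) : set 'M[R]_(m, n) :=
  [set Y | forall i j, 0 < Y i j].

(* Exponents of a Laurent monomial in the variables Y_{ij}, alpha_i, beta_i and
   (-1)^(n+1) gamma_i, in this order. *)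
Notation laurent_exponent n :=
  ('M[int]_(n - 2, n - 1) * {ffun 'I_n -> int} * {ffun 'I_n -> int} *
     {ffun 'I_n -> int})%type.

Definition laurent_monomial (R : realType) (n : nat)
    (Y : 'M[R]_(n - 2, n - 1)) (alpha beta gamma : 'I_n -> R)
    (e : laurent_exponent n) : R :=
  let: (eY, ealpha, ebeta, egamma) := e in
  (\prod_i \prod_j Y i j ^ eY i j) *
  (\prod_(k < n) alpha k ^ ealpha k) *
  (\prod_(k < n) beta k ^ ebeta k) *
  (\prod_(k < n) ((-1) ^+ n.+1 * gamma k) ^ egamma k).

(* A Laurent polynomial with coefficients 1 is given by the duplicate-free
   list of its exponents. *)
Definition laurent_sum (R : realType) (n : nat)
    (Y : 'M[R]_(n - 2, n - 1)) (alpha beta gamma : 'I_n -> R)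
    (L : seq (laurent_exponent n)) : R :=
  \sum_(e <- L) laurent_monomial Y alpha beta gamma e.

(* Main.v *)
Require Import Defs.
From HB Require Import structures.
From mathcomp Require Import all_boot all_order all_algebra.
From mathcomp Require Import complex.
From mathcomp Require Import classical_sets functions reals.
From mathcomp Require Import zify ring.

Set Implicit Arguments.
Unset Strict Implicit.
Unset Printing Implicit Defensive.

Import Order.TTheory GRing.Theory Num.Theory.
Local Open Scope classical_set_scope.
Local Open Scope ring_scope.
Local Open Scope complex_scope.

(** A gauge transformation that keeps the horizontal weights equal to 1 is given
    by a function g on the vertices b_{ij}: it multiplies a_{ij} by
    g_{ij} / g_{i,j+1} and b_{ij} by g_{ij} / g_{i+1,j}. So gauge classes are
    classes of scalar connections (a, b) on the square grid of the torus, X_{ij}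
    is the holonomy around a unit square, and the zig-zag monodromies are the
    holonomies along rows, along columns, and along antidiagonal staircases.

    Eigenvalues. Coordinates never decrease along a path, so A is lower and B is
    upper triangular, and their diagonal entries, the weights of the straight
    paths, are zig-zag monodromies. For B A^-1, close the lattice up in the
    column direction and record by a variable y the paths that go around: the
    n-step path operator becomes B + y A, while it is also a product of n
    one-step operators, one for each antidiagonal (transfer_pencil,
    det_transfer). Each of them is a cyclic bidiagonal matrix, whose determinant
    has two terms (det_cyclic_bidiagonal), so det (B + y A) is a product of n
    linear factors in y. At y = - X this is, up to the factor (-1)^n det A, the
    characteristic polynomial of B A^-1 (char_poly_BAinv).

    Uniqueness. The quotient of two connections with the same data has trivial
    holonomy along all rows, columns and staircases and around the unit squares
    (i, j) with i <= n - 3 and j <= n - 2. Dividing by a potential trivializes b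
    and the first row of a; then the unit squares propagate the value 1 of a down
    to row n - 2, the row products give the last column, and the antidiagonal
    products give the last row (flat_torus_connection).

    Existence. Conversely, choose the gauge with b_{ij} = 1 for i < n - 1 and
    a_{0j} = 1 for j < n - 1. Then b_{n-1,j} = beta_j, the entry a_{ij} with
    i, j < n - 1 is a product of Y_{kj} over k < i, and the row and antidiagonal
    products determine the last column and the last row. No root is extracted,
    so that all weights are Laurent monomials (monomial_connection).

    Coefficients 1. Every entry of A and of B is then a sum of monomials indexed
    by paths, and distinct paths must have distinct exponents. If two distinct
    paths of at most n steps leave a common position by different edges, double
    the weight of the SE edge used there by one of them, in the connection with
    all other weights 1: one path gets weight 2 and the other weight 1, since
    fewer than n steps cannot come back to that edge modulo n. This connection is
    gauge equivalent to the monomial connection with the same data, and gauge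
    equivalence preserves ratios of weights of paths with common ends, so the
    exponents differ (path_exponent_inj). *)

(** * Lattice paths *)

Lemma path_endE (i j : nat) (s : seq bool) :
  path_end i j s = (i + count id s, j + count negb s)%N.
Proof.
elim: s i j => [|[] s IHs] i j /=; first by rewrite !addn0.
  by rewrite IHs add0n addSnnS.
by rewrite IHs add0n addSnnS.
Qed.

Lemma path_end_antidiagonal (i j : nat) (s : seq bool) :
  ((path_end i j s).1 + (path_end i j s).2 = i + j + size s)%N.
Proof.
rewrite path_endE /= -(count_predC id s) addnACA.
by congr (_ + (_ + _))%N; apply: eq_count.
Qed.

Lemma path_weight_periodic (R : realType) (n : nat) (c : connection R n)
    (i j i' j' : nat) (s : seq bool) :
  i%:R = i'%:R :> 'Z_n -> j%:R = j'%:R :> 'Z_n ->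
  path_weight c i j s = path_weight c i' j' s.
Proof.
elim: s i j i' j' => [|[] s IHs] i j i' j' //= eqi eqj; rewrite eqi eqj;
  by congr (_ * _); apply: IHs => //; rewrite !mulrSr ?eqi ?eqj.
Qed.

Lemma sum_bool_tupleS (V : nmodType) (k : nat) (P : pred (seq bool))
    (F : seq bool -> V) :
  \sum_(s : k.+1.-tuple bool | P s) F s =
  \sum_(s : k.-tuple bool | P (true :: s)) F (true :: s) +
  \sum_(s : k.-tuple bool | P (false :: s)) F (false :: s).
Proof.
have h_bij: {on [pred s : k.+1.-tuple bool | P s],
    bijective (fun bt : bool * k.-tuple bool => [tuple of bt.1 :: bt.2])}.
  exists (fun s : k.+1.-tuple bool => (thead s, [tuple of behead s])).
    by move=> [b t] _; congr pair; apply: val_inj.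
  by move=> s _; case/tupleP: s => b t; apply: val_inj.
rewrite (reindex _ h_bij) /=.
rewrite (eq_bigl (fun bt : bool * k.-tuple bool =>
  predT bt.1 && P (bt.1 :: bt.2))) //.
rewrite -(pair_big_dep predT (fun b (t : k.-tuple bool) => P (b :: t))
  (fun b (t : k.-tuple bool) => F (b :: t))) /=.
by rewrite big_bool.
Qed.

(** * The eigenvalues of A, B and B A^-1 *)

(** In the expansion along the first column only two entries survive; their
    minors are triangular, with the p's and with the q's on the diagonal. *)
Lemma det_cyclic_bidiagonal (K : comNzRingType) (m : nat)
    (p q : 'I_m.+2 -> K) (y : K) :
  \det (\matrix_(i', i)
          ((i' == i :> nat)%:R * p i + (i'.+1 == i)%:R * q i +
           ((i == 0 :> nat) && (i' == m.+1 :> nat))%:R * (y * q i))) =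
  \prod_i p i + (-1) ^+ m.+1 * y * \prod_i q i.
Proof.
set M := \matrix_(_, _) _.
have entry_p (i' i : 'I_m.+2) : i' = i -> (i != 0 :> nat) -> M i' i = p i.
  move=> -> i0; rewrite mxE eqxx (negPf i0) (_ : _ == _ = false); last by lia.
  by rewrite mul1r !mul0r !addr0.
have entry_q (i' i : 'I_m.+2) : i'.+1 = i -> M i' i = q i.
  move=> ei; rewrite mxE -ei eqxx mul1r !mul0r addr0.
  by rewrite (_ : _ == _ = false) ?mul0r ?add0r //; lia.
have entry_0 (i' i : 'I_m.+2) : i' != i :> nat -> i'.+1 != i ->
    ~~ ((i == 0 :> nat) && (i' == m.+1 :> nat)) -> M i' i = 0.
  by move=> /negPf h1 /negPf h2 /negPf h3; rewrite mxE h1 h2 h3 !mul0r !addr0.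
rewrite (expand_det_col _ ord0) big_ord_recl big_ord_recr /=.
rewrite big1 ?add0r => [|i _]; last first.
  by rewrite entry_0 ?mul0r //= /bump /=; move: (ltn_ord i); lia.
rewrite /cofactor -(det_tr (row' ord0 _)) !det_trig; last 2 first.
- apply/is_trig_mxP => -[i hi] [j hj] /= ij; rewrite 2!mxE.
  by apply: entry_0; rewrite /= /bump ?leq0n; lia.
- apply/is_trig_mxP => -[i hi] [j hj] /= ij; rewrite 3!mxE.
  by apply: entry_0; rewrite /= /bump ?leq0n; lia.
rewrite [\prod_i p i]big_ord_recl [\prod_i q i]big_ord_recl.
congr (_ + _).
  rewrite expr0 mul1r mxE /= mul1r !mul0r !addr0; congr (_ * _).
  by apply: eq_bigr => i _; rewrite 3!mxE entry_p.
rewrite [M _ ord0]mxE /= /bump /= add1n eqxx !mul0r mul1r !add0r addn0.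
rewrite (eq_bigr (fun i => q (lift ord0 i))) => [|[i hi] _]; first by ring.
by rewrite 2!mxE entry_q //= /bump /=; lia.
Qed.

(** The total weight of the k-step paths from (i, j) to the columns congruent
    to j' modulo n, where y counts how often a path winds around. The number of
    windings is end column %/ n, which makes moving the start by n columns the
    same as multiplying by y. *)
Definition wrapped_sum (R : realType) (n : nat) (c : connection R n)
    (y : {poly R[i]}) (k i j j' : nat) : {poly R[i]} :=
  \sum_(s : k.-tuple bool | ((path_end i j s).2 %% n == j')%N)
    (path_weight c i j s)%:P * y ^+ (((path_end i j s).2 %/ n)%N).

Lemma wrapped_sumS (R : realType) (n : nat) (c : connection R n)
    (y : {poly R[i]}) (k i j j' : nat) :
  wrapped_sum c y k.+1 i j j' =
  (se c i%:R j%:R)%:P * wrapped_sum c y k i.+1 j j' +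
  (ne c i%:R j%:R)%:P * wrapped_sum c y k i j.+1 j'.
Proof.
rewrite /wrapped_sum (sum_bool_tupleS _
  (fun s => ((path_end i j s).2 %% n == j')%N)
  (fun s => (path_weight c i j s)%:P * y ^+ (((path_end i j s).2 %/ n)%N))).
by congr (_ + _); rewrite mulr_sumr; apply: eq_bigr => s _ /=;
  rewrite polyCM mulrA.
Qed.

Lemma wrapped_sum0 (R : realType) (n : nat) (c : connection R n)
    (y : {poly R[i]}) (i j j' : nat) : (j < n)%N ->
  wrapped_sum c y 0 i j j' = (j == j')%:R.
Proof.
move=> jn; rewrite /wrapped_sum.
rewrite (eq_bigl (fun s => (j == j') && (s == [tuple] :> 0.-tuple bool))).
  case: eqP => _; last by rewrite big_pred0.
  by rewrite (big_pred1 [tuple]) //= divn_small // expr0 mulr1.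
by move=> s; rewrite (tuple0 s) /= eqxx andbT modn_small.
Qed.

Lemma wrapped_sum_row (R : realType) (m : nat) (c : connection R m.+2)
    (y : {poly R[i]}) (k i j j' : nat) :
  wrapped_sum c y k (i + m.+2)%N j j' = wrapped_sum c y k i j j'.
Proof.
rewrite /wrapped_sum; apply: eq_big => [s|s _].
  by rewrite !path_endE.
rewrite !path_endE /=.
congr (_%:P * _); apply: path_weight_periodic => //.
by rewrite natrD pchar_Zp // addr0.
Qed.

Lemma wrapped_sum_col (R : realType) (m : nat) (c : connection R m.+2)
    (y : {poly R[i]}) (k i j j' : nat) :
  wrapped_sum c y k i (j + m.+2)%N j' = y * wrapped_sum c y k i j j'.
Proof.
rewrite /wrapped_sum mulr_sumr; apply: eq_big => [s|s _].
  by rewrite !path_endE /= addnAC modnDr.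
rewrite !path_endE /= addnAC.
rewrite divnDr // divnn /= addn1 exprS mulrCA.
congr (_ * (_%:P * _)); apply: path_weight_periodic => //.
by rewrite natrD pchar_Zp // addr0.
Qed.

(** The k-step path operator that starts on the antidiagonal l + n - 1, whose
    i-th position is (l + i, n - 1 - i). *)
Definition transfer (R : realType) (m : nat) (c : connection R m.+2)
    (y : {poly R[i]}) (k l : nat) : 'M[{poly R[i]}]_m.+2 :=
  \matrix_(i', i) wrapped_sum c y k (l + i)%N (m.+1 - i)%N (m.+1 - i')%N.

(** Taking the first step is multiplication by a cyclic bidiagonal matrix: SE
    keeps the index i, NE lowers it by one, and NE from index 0 leaves through
    column n, which is column 0 with the row shifted by n, at the cost of y. *)
Lemma det_transfer (R : realType) (m : nat) (c : connection R m.+2)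
    (y : {poly R[i]}) (k l : nat) :
  \det (transfer c y k l) =
  \prod_(t < k)
    (\prod_(i < m.+2) (se c (l + t + i)%N%:R (m.+1 - i)%N%:R)%:P +
     (-1) ^+ m.+1 * y * \prod_(i < m.+2) (ne c (l + t + i)%N%:R (m.+1 - i)%N%:R)%:P).
Proof.
elim: k l => [|k IHk] l.
  rewrite big_ord0 (_ : transfer c y 0 l = 1%:M) ?det1 //.
  apply/matrixP => i' i; rewrite !mxE wrapped_sum0; last by lia.
  by congr (_%:R : _); congr (nat_of_bool _); rewrite -val_eqE /=;
    move: (ltn_ord i) (ltn_ord i'); lia.
rewrite big_ord_recl -det_cyclic_bidiagonal.
have -> : transfer c y k.+1 l = transfer c y k l.+1 *m
  (\matrix_(i', i)
          ((i' == i :> nat)%:R * (se c (l + i)%N%:R (m.+1 - i)%N%:R)%:P +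
           (i'.+1 == i)%:R * (ne c (l + i)%N%:R (m.+1 - i)%N%:R)%:P +
           ((i == 0 :> nat) && (i' == m.+1 :> nat))%:R *
             (y * (ne c (l + i)%N%:R (m.+1 - i)%N%:R)%:P))).
  apply/matrixP => i' i; rewrite !mxE wrapped_sumS.
  under eq_bigr => h _ do rewrite !mxE !mulrDr.
  rewrite !big_split /= -addrA; congr (_ + _).
    rewrite (bigD1 i) //= big1 ?addr0 => [|h /negPf].
      by rewrite eqxx mul1r mulrC addSn.
    by rewrite -val_eqE /= => ->; rewrite mul0r mulr0.
  case: (unliftP ord0 i) => [i0|] ->.
    rewrite [X in _ = _ + X]big1 ?addr0 => [|h _]; last by rewrite /= mul0r mulr0.
    rewrite (bigD1 (widen_ord (leqnSn m.+1) i0)) //= big1 ?addr0 => [|h].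
      rewrite /bump /= eqxx mul1r mulrC addnS -addSn -subSn ?subSS //.
    rewrite -val_eqE /= /bump /= add1n eqSS => /negPf ->.
    by rewrite mul0r mulr0.
  rewrite [X in _ = X + _]big1 ?add0r => [|h _]; last by rewrite /= mul0r mulr0.
  rewrite (bigD1 ord_max) //= big1 ?addr0 => [|h].
    rewrite eqxx mul1r subn0 subnn addn0 addSnnS wrapped_sum_row.
    by rewrite (wrapped_sum_col c y k l 0) mulrC mulrAC mulrC mulrA.
  by rewrite -val_eqE /= => /negPf ->; rewrite mul0r mulr0.
rewrite det_mulmx mulrC IHk; congr (_ * _).
  by congr (\det _); apply/matrixP => i' i; rewrite !mxE addn0.
apply: eq_bigr => t _; rewrite /= /bump /= add1n -addSnnS.
by [].
Qed.

(** After n steps a path has crossed either row n or column n, but not both: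
    it contributes to B if its end column is below n, and to A, with one
    winding, otherwise. *)
Lemma transfer_pencil (R : realType) (m : nat) (c : connection R m.+2)
    (y : {poly R[i]}) :
  transfer c y m.+2 0 = map_mx polyC (matB c) + y *: map_mx polyC (matA c).
Proof.
apply/matrixP => i' i; rewrite !mxE add0n /wrapped_sum subn1 /=.
have end_sum (s : m.+2.-tuple bool) : ((path_end i (m.+1 - i) s).1 +
    (path_end i (m.+1 - i) s).2 = m.+1 + m.+2)%N.
  by rewrite path_end_antidiagonal size_tuple; move: (ltn_ord i); lia.
have hi' := ltn_ord i'.
rewrite
  (bigID (fun s : m.+2.-tuple bool => (path_end i (m.+1 - i) s).2 < m.+2)%N) /=.
congr (_ + _).
  rewrite rmorph_sum /=; apply: eq_big => [s|s /andP[_ lt2]].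
    have := end_sum s; case: (path_end _ _ _) => [e1 e2] /= es.
    case: ltnP => h; rewrite ?andbF ?andbT ?modn_small //.
    by apply/esym/eqP; lia.
  by rewrite divn_small // expr0 mulr1.
rewrite rmorph_sum /= mulr_sumr; apply: eq_big => [s|s /andP[_ ge2]].
  have := end_sum s; case: (path_end _ _ _) => [e1 e2] /= es.
  case: ltnP => h; rewrite ?andbF ?andbT; first by apply/esym/eqP; lia.
  rewrite -(subnK h) modnDr modn_small; last by lia.
  by apply/eqP/eqP; lia.
have := end_sum s; move: ge2; case: (path_end _ _ _) => [e1 e2] /=.
rewrite -leqNgt => h es; rewrite -(subnK h) divnDr // divnn /=.
rewrite divn_small; last by lia.
by rewrite add0n expr1 mulrC.
Qed.

Lemma prod_Zn_shift (K : comNzRingType) (m l : nat) (F : 'Z_m.+2 -> K) :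
  \prod_(t < m.+2) F (l + t)%N%:R = \prod_(k : 'Z_m.+2) F k.
Proof.
rewrite [RHS](reindex_inj (@addrI _ (l%:R : 'Z_m.+2))) /=.
by apply: eq_bigr => t _; rewrite natrD natr_Zp.
Qed.

Lemma prod_antidiagonal (K : comNzRingType) (m : nat)
    (F : 'Z_m.+2 -> 'Z_m.+2 -> K) (k : 'Z_m.+2) :
  \prod_i \prod_(j | i + j == k) F i j = \prod_i F i (k - i).
Proof.
apply: eq_bigr => i _; apply: big_pred1 => j /=.
by rewrite [RHS]eq_sym subr_eq eq_sym addrC.
Qed.

(** The positions (l + i, n - 1 - i) run once through an antidiagonal of the
    torus. *)
Lemma prod_antidiagonal_path (K : comNzRingType) (m l : nat)
    (F : 'Z_m.+2 -> 'Z_m.+2 -> K) :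
  \prod_(i < m.+2) F (l + i)%N%:R (m.+1 - i)%N%:R =
  \prod_i \prod_(j | i + j == (m.+1 + l)%N%:R) F i j.
Proof.
rewrite prod_antidiagonal [RHS](reindex_inj (@addrI _ (l%:R : 'Z_m.+2))) /=.
apply: eq_bigr => i _; rewrite natrD natr_Zp; congr F.
have hi : (i <= m.+1)%N by rewrite -ltnS ltn_ord.
by rewrite natrB // natr_Zp natrD opprD addrA addrK.
Qed.

Lemma prod_all_antidiagonals (K : comNzRingType) (m : nat)
    (F : 'Z_m.+2 -> 'Z_m.+2 -> K) :
  \prod_k \prod_i \prod_(j | i + j == k) F i j = \prod_i \prod_j F i j.
Proof.
rewrite exchange_big /=; apply: eq_bigr => i _.
rewrite [RHS](reindex_inj (@addIr _ (- i))) /=.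
apply: eq_bigr => k _; apply: big_pred1 => j.
by rewrite /= eq_sym addrC eq_sym -(inj_eq (@addIr _ (- i))) addrK.
Qed.

Lemma matA_trig (R : realType) (m : nat) (c : connection R m.+2) :
  is_trig_mx (matA c).
Proof.
apply/is_trig_mxP => i' i lt_i; rewrite mxE big_pred0 // => s.
by rewrite path_endE /=; lia.
Qed.

Lemma matB_trig (R : realType) (m : nat) (c : connection R m.+2) :
  is_trig_mx (matB c)^T.
Proof.
apply/is_trig_mxP => i i' lt_i; rewrite !mxE big_pred0 // => s.
by rewrite path_endE /=; move: (ltn_ord i) (ltn_ord i'); lia.
Qed.

Lemma count0_nseq (k : nat) (b : bool) (s : k.-tuple bool) :
  (count (pred1 b) s == 0)%N = (s == [tuple of nseq k (~~ b)]).
Proof.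
rewrite eqn0Ngt -has_count -all_predC (@eq_all _ _ (pred1 (~~ b))); last first.
  by move=> x /=; case: x; case: b.
by rewrite -(inj_eq val_inj) /=; apply/all_pred1P/eqP => [->|->];
  rewrite ?size_tuple ?size_nseq.
Qed.

Lemma path_weight_NE (R : realType) (n : nat) (c : connection R n)
    (k i j : nat) :
  path_weight c i j (nseq k false) = \prod_(t < k) ne c i%:R (j + t)%N%:R.
Proof.
elim: k j => [|k IHk] j /=; first by rewrite big_ord0.
rewrite big_ord_recl addn0 IHk; congr (_ * _).
by apply: eq_bigr => t _; rewrite /= /bump /= add1n addSnnS.
Qed.

Lemma path_weight_SE (R : realType) (n : nat) (c : connection R n)
    (k i j : nat) :
  path_weight c i j (nseq k true) = \prod_(t < k) se c (i + t)%N%:R j%:R.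
Proof.
elim: k i => [|k IHk] i /=; first by rewrite big_ord0.
rewrite big_ord_recl addn0 IHk; congr (_ * _).
by apply: eq_bigr => t _; rewrite /= /bump /= add1n addSnnS.
Qed.

Lemma matA_diag (R : realType) (m : nat) (c : connection R m.+2) (i : 'I_m.+2) :
  horizontal1 c -> matA c i i = zigzagNE c i%:R.
Proof.
move=> hor1; rewrite mxE (big_pred1 [tuple of nseq m.+2 (~~ true)]) => [|s].
  rewrite path_weight_NE (prod_Zn_shift _ (ne c i%:R)).
  by apply: eq_bigr => j _; rewrite hor1 divr1.
rewrite -[RHS]/(s == [tuple of nseq m.+2 (~~ true)]) -count0_nseq path_endE /=.
by rewrite -[X in _ == X]addn0 eqn_add2l; congr (_ == _); apply: eq_count => -[].
Qed.

Lemma matB_diag (R : realType) (m : nat) (c : connection R m.+2) (i : 'I_m.+2) :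
  horizontal1 c -> matB c i i = zigzagSE c (rev_ord i)%:R.
Proof.
move=> hor1; rewrite mxE (big_pred1 [tuple of nseq m.+2 (~~ false)]) => [|s].
  rewrite path_weight_SE (prod_Zn_shift _ (fun k => se c k _)).
  by apply: eq_bigr => j _; rewrite hor1 divr1 /= subn1 subSS.
rewrite -[RHS]/(s == [tuple of nseq m.+2 (~~ false)]) -count0_nseq path_endE /=.
by rewrite -[X in _ == X]addn0 eqn_add2l; congr (_ == _); apply: eq_count => -[].
Qed.

Lemma det_matA (R : realType) (m : nat) (c : connection R m.+2) :
  horizontal1 c -> \det (matA c) = \prod_i \prod_j ne c i j.
Proof.
move=> hor1; rewrite det_trig ?matA_trig //; apply: eq_bigr => i _.
by rewrite matA_diag // natr_Zp; apply: eq_bigr => j _; rewrite hor1 divr1.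
Qed.

Lemma matA_unit (R : realType) (m : nat) (c : connection R m.+2) :
  horizontal1 c -> matA c \in unitmx.
Proof.
move=> hor1; rewrite unitmxE det_matA // unitfE.
by apply/prodf_neq0 => i _; apply/prodf_neq0 => j _; apply: ne_neq0.
Qed.

Lemma matB_unit (R : realType) (m : nat) (c : connection R m.+2) :
  horizontal1 c -> matB c \in unitmx.
Proof.
move=> hor1; rewrite -unitmx_tr unitmxE det_trig ?matB_trig // unitfE.
apply/prodf_neq0 => j _; rewrite mxE matB_diag //.
by apply/prodf_neq0 => i _; rewrite hor1 divr1 se_neq0.
Qed.

Lemma det_pencil (R : realType) (m : nat) (c : connection R m.+2)
    (y : {poly R[i]}) :
  \det (map_mx polyC (matB c) + y *: map_mx polyC (matA c)) =
  \prod_(k : 'Z_m.+2)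
    ((\prod_i \prod_(j | i + j == k) se c i j)%:P +
     (-1) ^+ m.+1 * y * (\prod_i \prod_(j | i + j == k) ne c i j)%:P).
Proof.
rewrite -transfer_pencil det_transfer.
rewrite -(prod_Zn_shift m.+1 (fun k =>
  (\prod_i \prod_(j | i + j == k) se c i j)%:P +
  (-1) ^+ m.+1 * y * (\prod_i \prod_(j | i + j == k) ne c i j)%:P)).
apply: eq_bigr => t _; rewrite add0n -!prod_antidiagonal_path.
by rewrite !rmorph_prod.
Qed.

(** On an antidiagonal k, the factor of det (B - X A) is
    prod b - (-1)^(n-1) X prod a, and prod b = z^S_k prod a; so up to signs it is
    X - (-1)^(n+1) z^S_k times prod a, and the factors prod a multiply to det A. *)
Lemma char_poly_BAinv (R : realType) (m : nat) (c : connection R m.+2) :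
  horizontal1 c ->
  char_poly (matB c *m invmx (matA c)) =
  \prod_(k : 'Z_m.+2) ('X - ((-1) ^+ m.+3 * zigzagS c k)%:P).
Proof.
move=> hor1; set A := matA c; set B := matB c.
pose a k := \prod_i \prod_(j | i + j == k) ne c i j.
have a0 k : a k != 0.
  by apply/prodf_neq0 => i _; apply/prodf_neq0 => j _; apply: ne_neq0.
have A0 : (\det A)%:P != 0 :> {poly R[i]}.
  by rewrite polyC_eq0 -unitfE -unitmxE matA_unit.
apply: (mulIf A0).
have -> : char_poly (B *m invmx A) * (\det A)%:P =
    \det (map_mx polyC B + (- 'X) *: map_mx polyC A) * (-1) ^+ m.+2.
  rewrite -det_map_mx /char_poly -det_mulmx mulrC -detZ; congr (\det _).
  rewrite scaleN1r /char_poly_mx mulmxBl -map_mxM mulmxKV ?matA_unit //.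
  by rewrite mul_scalar_mx opprD scaleNr opprK addrC.
rewrite det_pencil det_matA // -prod_all_antidiagonals rmorph_prod -big_split /=.
(* The global sign is spread over the factors: n ^ 2 and n have one parity. *)
have -> : (-1) ^+ m.+2 = \prod_(k : 'Z_m.+2) (-1) ^+ m.+2 :> {poly R[i]}.
  by rewrite prodr_const card_ord -exprM -signr_odd -[RHS]signr_odd oddM andbb.
rewrite -big_split /=.
apply: eq_bigr => k _; rewrite -/(a k).
have -> : \prod_i \prod_(j | i + j == k) se c i j = zigzagS c k * a k.
  rewrite -big_split; apply: eq_bigr => i _; rewrite -big_split.
  by apply: eq_bigr => j _; rewrite /= divfK ?ne_neq0.
have sgnE : ((-1) ^+ m.+3 : R[i])%:P = - (-1) ^+ m.+2.
  by rewrite polyC_exp polyCN exprS mulN1r.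
rewrite [((-1) ^+ _ * _)%:P]polyCM sgnE !polyCM.
have := sqrr_sign {poly R[i]} m.+1; rewrite (exprS _ m.+1).
by set e := (-1) ^+ m.+1 => he; ring: he.
Qed.

Lemma char_poly_tr (K : comNzRingType) (n : nat) (A : 'M[K]_n) :
  char_poly A^T = char_poly A.
Proof.
rewrite /char_poly -[RHS]det_tr; congr (\det _).
by apply/matrixP => i j; rewrite !mxE [j == i]eq_sym.
Qed.

Lemma OmegaPlus_sub_Omega (R : realType) (m : nat)
    (alpha beta gamma : 'I_m.+2 -> R) :
  OmegaPlus alpha beta gamma `<=`
  Omega (fun k => (alpha k)%:C) (fun k => (beta k)%:C) (fun k => (gamma k)%:C).
Proof.
move=> _ [c [hor1 [_ zz] ->]]; exists (matA c), (matB c).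
have zzP k : [/\ zigzagNE c k = (alpha k)%:C, zigzagSE c k = (beta k)%:C
    & zigzagS c k = ((-1) ^+ m.+3 * gamma k)%:C].
  by have := zz k; rewrite natr_Zp.
split => //; first by rewrite matA_unit ?matB_unit.
- rewrite /has_eigenvalues char_poly_trig ?matA_trig //.
  by apply: eq_bigr => i _; rewrite matA_diag // natr_Zp; case: (zzP i) => ->.
- rewrite /has_eigenvalues -char_poly_tr char_poly_trig ?matB_trig //.
  rewrite [RHS](reindex_inj rev_ord_inj) /=; apply: eq_bigr => i _.
  by rewrite mxE matB_diag // natr_Zp; case: (zzP (rev_ord i)) => _ ->.
- rewrite /has_eigenvalues char_poly_BAinv //.
  apply: eq_bigr => k _; case: (zzP k) => _ _ ->.
  have -> : ((-1) ^+ m.+3 * gamma k)%:C = (-1) ^+ m.+3 * (gamma k)%:C.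
    by rewrite rmorphM rmorphXn rmorphN1.
  by rewrite mulrA -expr2 sqrr_sign mul1r.
Qed.

(** * Gauge classes are determined by their face weights and zig-zags *)

Lemma val_Zn_succ (m : nat) (i : 'Z_m.+2) : (i < m.+1)%N -> (i + 1)%R = i.+1 :> nat.
Proof. by move=> hi; rewrite /= (modn_small (m := 1)) // addn1 modn_small. Qed.

Lemma Zn_max_succ (m : nat) (i : 'Z_m.+2) : i = m.+1 :> nat -> i + 1 = 0.
Proof.
by move=> hi; apply: val_inj; rewrite /= hi (modn_small (m := 1)) // addn1 modnn.
Qed.

(** Partial products extend cyclically: at the last index, i + 1 is 0 and the
    partial product starts again from 1, which is the total product. *)
Lemma partial_prod_succ (F : fieldType) (m : nat) (f : 'Z_m.+2 -> F)
    (i : 'Z_m.+2) : \prod_k f k = 1 ->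
  \prod_(k : 'Z_m.+2 | (k < (i + 1)%R)%N) f k =
  \prod_(k : 'Z_m.+2 | (k < i)%N) f k * f i.
Proof.
move=> f1; have hi : (i <= m.+1)%N by rewrite -ltnS; apply: ltn_ord.
have prodS : \prod_(k : 'Z_m.+2 | (k < i.+1)%N) f k =
    \prod_(k : 'Z_m.+2 | (k < i)%N) f k * f i.
  rewrite (bigD1 i) ?ltnS //= mulrC; congr (_ * _).
  by apply: eq_bigl => k; rewrite ltnS ltn_neqAle andbC.
case: (ltngtP i m.+1) hi => // hi _; first by rewrite val_Zn_succ.
rewrite Zn_max_succ // big_pred0 // -prodS -[LHS]f1; apply: eq_bigl => k.
by rewrite hi (ltn_ord k).
Qed.

Lemma prod_eq1_max (F : fieldType) (m : nat) (f : 'Z_m.+2 -> F) :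
  \prod_k f k = 1 -> (forall k : 'Z_m.+2, (k < m.+1)%N -> f k = 1) ->
  forall k, f k = 1.
Proof.
move=> f1 fk k; have : (k <= m.+1)%N by rewrite -ltnS; apply: ltn_ord.
rewrite leq_eqVlt => /predU1P[hk|]; last exact: fk.
rewrite -[RHS]f1 (bigD1 k) //= big1 ?mulr1 // => l lk; apply: fk.
have := ltn_ord l; rewrite ltnS leq_eqVlt => /predU1P[hl|//].
by case/eqP: lk; apply: val_inj; rewrite /= hk.
Qed.

(** The potential g is the inverse of the holonomy from (0, 0) along the first
    row and then along a column. It trivializes b and the first row of a; what
    remains of a is called a' below. *)
Lemma flat_torus_connection (F : fieldType) (m : nat)
    (a b : 'Z_m.+2 -> 'Z_m.+2 -> F) :
  (forall i j, a i j != 0) -> (forall i j, b i j != 0) ->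
  (forall i, \prod_j a i j = 1) -> (forall j, \prod_i b i j = 1) ->
  (forall k, \prod_i \prod_(j | i + j == k) (b i j / a i j) = 1) ->
  (forall i j : 'Z_m.+2, (i < m)%N -> (j < m.+1)%N ->
     b i j * a (i + 1) j = a i j * b i (j + 1)) ->
  exists2 g : 'Z_m.+2 -> 'Z_m.+2 -> F, forall i j, g i j != 0 &
    forall i j, a i j = g i j / g i (j + 1) /\ b i j = g i j / g (i + 1) j.
Proof.
move=> a0 b0 rowa colb diag face.
have [g gE] : exists g : 'Z_m.+2 -> 'Z_m.+2 -> F, forall i j,
    g i j = (\prod_(l : 'Z_m.+2 | (l < j)%N) a 0 l *
             \prod_(k : 'Z_m.+2 | (k < i)%N) b k j)^-1 by eexists.
have g0 i j : g i j != 0.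
  by rewrite gE invr_eq0 mulf_neq0 //; apply/prodf_neq0.
have gb i j : b i j = g i j / g (i + 1) j.
  rewrite !gE (partial_prod_succ _ (colb j)) invrK.
  rewrite [_ * (_ * b i j)]mulrA mulKf //.
  by rewrite mulf_neq0 //; apply/prodf_neq0.
pose a' i j := a i j * g i (j + 1) / g i j.
have aE i j : a i j = a' i j * (g i j / g i (j + 1)).
  by rewrite /a' mulrA divfK // mulfK.
suff a'1 i j : a' i j = 1.
  by exists g => // i j; split; [rewrite aE a'1 mul1r | exact: gb].
have rowa' r : \prod_s a' r s = 1.
  rewrite /a' big_split /= big_split /= rowa mul1r prodfV.
  have -> : \prod_s g r (s + 1) = \prod_s g r s.
    by rewrite [RHS](reindex_inj (@addIr _ (1 : 'Z_m.+2))).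
  by rewrite divff //; apply/prodf_neq0.
have a'0 s : a' 0 s = 1.
  rewrite /a' !gE (partial_prod_succ _ (rowa 0)).
  rewrite ![\prod_(k : 'Z_m.+2 | (k < _)%N) b k _]big_pred0 //.
  rewrite !mulr1 invrK mulrAC (mulrC _ (a 0 s)) divff // mulf_neq0 //.
  exact/prodf_neq0.
(* The unit squares transport a' from each row to the next one. *)
have a'succ (r s : 'Z_m.+2) : (r < m)%N -> (s < m.+1)%N -> a' (r + 1) s = a' r s.
  move=> hr hs; have := face r s hr hs; rewrite !gb /a' => hf.
  have {hf} -> : a (r + 1) s = a r s * (g r (s + 1) / g (r + 1) (s + 1)) *
      (g r s / g (r + 1) s)^-1.
    by rewrite -hf mulrC mulKf // mulf_neq0 ?invr_eq0.
  by field; rewrite !g0.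
have a'top (r s : 'Z_m.+2) : (r < m.+1)%N -> a' r s = 1.
  move=> hr; apply: (prod_eq1_max (rowa' r)) => {}s hs.
  have : forall k : nat, (k < m.+1)%N -> a' k%:R s = 1.
    elim=> [|k IHk] hk; first exact: a'0.
    rewrite mulrSr a'succ ?IHk //; first exact: ltnW.
    by rewrite val_Zp_nat // modn_small //; lia.
  by move/(_ r hr); rewrite natr_Zp.
(* In b / a, the potential only contributes factors that cancel along an
   antidiagonal. *)
have diaga' (k : 'Z_m.+2) : \prod_r a' r (k - r) = 1.
  have := diag k; rewrite prod_antidiagonal => h.
  apply: invr_inj; rewrite invr1 -[RHS]h -prodfV.
  transitivity (\prod_r ((a' r (k - r))^-1 * (g r (k - r + 1) / g (r + 1) (k - r)))).
    rewrite big_split /= prodf_div.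
    have -> : \prod_r g r (k - r + 1) = \prod_r g (r + 1) (k - r).
      rewrite (reindex_inj (@addIr _ (1 : 'Z_m.+2))) /=.
      by apply: eq_bigr => r _; rewrite opprD addrA subrK.
    by rewrite divff ?mulr1 //; apply/prodf_neq0.
  have a'n0 (r s : 'Z_m.+2) : a' r s != 0 by rewrite !mulf_neq0 ?invr_eq0.
  by apply: eq_bigr => r _; rewrite gb aE; field; rewrite !g0 a'n0.
suff : forall r k : 'Z_m.+2, a' r (k - r) = 1 by move/(_ i (j + i)); rewrite addrK.
move=> r k; apply: (@prod_eq1_max _ _ (fun r => a' r (k - r))) => //.
by move=> {}r hr; apply: a'top.
Qed.

(** Applies flat_torus_connection to the quotient of the connections, in which
    the horizontal weights h are first absorbed into the white vertices; the
    products of h that this creates cancel in every zig-zag. *)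
Lemma same_data_gauge_equiv (R : realType) (m : nat) (c c' : connection R m.+2) :
  (forall i, zigzagNE c' i = zigzagNE c i) ->
  (forall j, zigzagSE c' j = zigzagSE c j) ->
  (forall k, zigzagS c' k = zigzagS c k) ->
  (forall i j : 'Z_m.+2, (i < m)%N -> (j < m.+1)%N ->
     face_weight c' i j = face_weight c i j) ->
  gauge_equiv c c'.
Proof.
move=> eqNE eqSE eqS eqX.
have nz := (hor_neq0, ne_neq0, se_neq0).
pose h i j := hor c' i j / hor c i j.
have h0 i j : h i j != 0 by rewrite mulf_neq0 ?invr_eq0 ?nz.
have prod_shift (f : 'Z_m.+2 -> R[i]) : \prod_j f (j + 1) = \prod_j f j.
  by rewrite [RHS](reindex_inj (@addIr _ (1 : 'Z_m.+2))).
have [||||||g g0 gE] := @flat_torus_connection _ m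
  (fun i j => ne c' i j / ne c i j / h i (j + 1))
  (fun i j => se c' i j / se c i j / h (i + 1) j).
- by move=> i j; rewrite !mulf_neq0 ?invr_eq0 ?nz.
- by move=> i j; rewrite !mulf_neq0 ?invr_eq0 ?nz.
- move=> i; rewrite prodf_div (prod_shift (h i)) -prodf_div.
  transitivity (zigzagNE c' i / zigzagNE c i).
    rewrite /zigzagNE -prodf_div; apply: eq_bigr => j _; rewrite /h.
    by field; rewrite !nz.
  by rewrite eqNE divff //; apply/prodf_neq0 => j _; rewrite mulf_neq0 ?invr_eq0 ?nz.
- move=> j; rewrite prodf_div (prod_shift (h^~ j)) -prodf_div.
  transitivity (zigzagSE c' j / zigzagSE c j).
    rewrite /zigzagSE -prodf_div; apply: eq_bigr => i _; rewrite /h.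
    by field; rewrite !nz.
  by rewrite eqSE divff //; apply/prodf_neq0 => i _; rewrite mulf_neq0 ?invr_eq0 ?nz.
- move=> k; rewrite prod_antidiagonal.
  transitivity (zigzagS c' k / zigzagS c k *
     (\prod_i h i (k - i + 1) / \prod_i h (i + 1) (k - i))).
    rewrite /zigzagS !prod_antidiagonal -!prodf_div -big_split /=.
    by apply: eq_bigr => i _; field; rewrite !nz !h0.
  have -> : \prod_i h i (k - i + 1) = \prod_i h (i + 1) (k - i).
    rewrite -(prod_shift (fun i => h i (k - i + 1))).
    by apply: eq_bigr => r _; rewrite opprD addrA subrK.
  rewrite eqS !divff ?mulr1 //; first by apply/prodf_neq0.
  by rewrite /zigzagS prod_antidiagonal; apply/prodf_neq0 => i _;
    rewrite mulf_neq0 ?invr_eq0 ?nz.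
- move=> i j hi hj; have := eqX i j hi hj.
  (* Multiplying by the ratio of the two face weights turns the square of a into
     the square of b. *)
  have X0 : face_weight c i j != 0 by rewrite !mulf_neq0 ?invr_eq0 ?nz.
  move/(congr1 (fun x => x / face_weight c i j)); rewrite divff // => eq1.
  rewrite -[RHS]mulr1 -eq1 /face_weight /h.
  by field; rewrite !nz.
exists g, (fun i j => h i j / g i j); split=> i j.
  by rewrite g0 mulf_neq0 ?invr_eq0.
split.
- by rewrite /h; field; rewrite !nz g0.
- have [eqa _] := gE i j.
  transitivity (ne c i j * h i (j + 1) * (ne c' i j / ne c i j / h i (j + 1))).
    by field; rewrite nz h0.
  by rewrite eqa; field; rewrite g0.
- have [_ eqb] := gE i j.
  transitivity (se c i j * h (i + 1) j * (se c' i j / se c i j / h (i + 1) j)).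
    by field; rewrite nz h0.
  by rewrite eqb; field; rewrite g0.
Qed.

(** * Gauge transformations conjugate A and B *)

Lemma gauge_horizontal1 (R : realType) (n : nat) (c c' : connection R n) :
  horizontal1 c -> horizontal1 c' -> gauge_equiv c c' ->
  exists2 g : 'Z_n -> 'Z_n -> R[i], forall i j, g i j != 0 &
    forall i j, ne c' i j = g i j / g i (j + 1) * ne c i j /\
                se c' i j = g i j / g (i + 1) j * se c i j.
Proof.
move=> hor1 hor1' [g [gw [g0 gE]]].
have gwE i j : gw i j = (g i j)^-1.
  have [+ _ _] := gE i j; rewrite hor1 hor1' mulr1 => gK.
  by apply: (mulfI (proj1 (g0 i j))); rewrite -gK divff //; case: (g0 i j).
exists g => i j; first by case: (g0 i j).
by have [_ -> ->] := gE i j; rewrite !gwE.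
Qed.

(** The factors at the interior vertices of a path cancel. *)
Lemma path_weight_gauge (R : realType) (n : nat) (c c' : connection R n)
    (g : 'Z_n -> 'Z_n -> R[i]) :
  (forall i j, g i j != 0) ->
  (forall i j, ne c' i j = g i j / g i (j + 1) * ne c i j /\
               se c' i j = g i j / g (i + 1) j * se c i j) ->
  forall (i j : nat) (s : seq bool),
  path_weight c' i j s =
  g i%:R j%:R / g (path_end i j s).1%:R (path_end i j s).2%:R *
  path_weight c i j s.
Proof.
move=> g0 gE i j s; elim: s i j => [|[] s IHs] i j /=.
- by rewrite divff // mulr1.
- by rewrite IHs; have [_ ->] := gE i%:R j%:R; rewrite mulrSr; field; rewrite !g0.
- by rewrite IHs; have [-> _] := gE i%:R j%:R; rewrite mulrSr; field; rewrite !g0.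
Qed.

Lemma invmx_mulmx (F : fieldType) (n : nat) (P Q : 'M[F]_n) :
  P \in unitmx -> Q \in unitmx -> invmx (P *m Q) = invmx Q *m invmx P.
Proof.
move=> uP uQ; have uPQ : P *m Q \in unitmx by rewrite unitmx_mul uP.
apply: (can_inj (mulKmx uPQ)); rewrite mulmxV //.
by rewrite -mulmxA [Q *m _]mulmxA mulmxV // mul1mx mulmxV.
Qed.

Lemma conj_classJ (R : realType) (n : nat) (A B P : 'M[R[i]]_n) :
  P \in unitmx ->
  conj_class (P *m A *m invmx P) (P *m B *m invmx P) = conj_class A B.
Proof.
move=> uP; apply/seteqP; split=> _ [Q uQ ->].
  exists (Q *m P); rewrite ?unitmx_mul ?uQ //.
  by rewrite invmx_mulmx // !mulmxA.
exists (Q *m invmx P); rewrite ?unitmx_mul ?unitmx_inv ?uQ //.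
by rewrite invmx_mulmx ?unitmx_inv // invmxK !mulmxA !mulmxKV.
Qed.

(** A path of n steps from the i-th position of an antidiagonal to the i'-th one
    ends at the same vertex of the torus as position i', so the end factors of
    path_weight_gauge form a conjugation by a diagonal matrix. *)
Lemma conj_class_gauge (R : realType) (m : nat) (c c' : connection R m.+2) :
  horizontal1 c -> horizontal1 c' -> gauge_equiv c c' ->
  conj_class (matA c') (matB c') = conj_class (matA c) (matB c).
Proof.
move=> hor1 hor1' /(gauge_horizontal1 hor1 hor1')[g g0 gE].
pose d i : R[i] := (g i%:R (m.+1 - i)%N%:R)^-1.
have d0 i : d i != 0 by rewrite invr_eq0.
pose P : 'M_m.+2 := diag_mx (\row_i d i).
have uP : P \in unitmx.
  rewrite unitmxE det_diag unitfE; apply/prodf_neq0 => i _; by rewrite mxE.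
have ZnD (k : nat) : (k + m.+2)%N%:R = k%:R :> 'Z_m.+2.
  by rewrite natrD pchar_Zp // addr0.
have eqJ (M M' : 'M_m.+2) : (forall i' i, M' i' i = d i' / d i * M i' i) ->
    M' = P *m M *m invmx P.
  move=> MM'; apply: (canRL (mulmxK uP)).
  apply/matrixP => i' i; rewrite mul_mx_diag mul_diag_mx !mxE MM'.
  by field; rewrite d0.
rewrite -[RHS](conj_classJ _ _ uP); congr conj_class; apply: eqJ => i' i;
  rewrite !mxE mulr_sumr; apply: eq_bigr => s; rewrite (path_weight_gauge g0 gE);
  have := path_end_antidiagonal i (m.+2 - 1 - i) s; rewrite size_tuple;
  case: (path_end _ _ _) => [e1 e2] /= es /eqP he;
  have hi := ltn_ord i; have hi' := ltn_ord i'.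
  have -> : e2 = (m.+1 - i' + m.+2)%N by lia.
  by rewrite ZnD he /d invrK subn1 /= [_ / _]mulrC.
have -> : e1 = (i' + m.+2)%N by lia.
by rewrite ZnD he /d invrK subn1 /= [_ / _]mulrC.
Qed.

(** * A normal form with Laurent monomial weights *)

(** Written additively, these are the weights of the normal form. On the rows
    i < n - 1, the sum of y over k < i makes the unit squares correct, and the
    last column makes the sum of row i equal to al i. *)
Definition normal_top (V : zmodType) (m : nat) (y : nat -> nat -> V)
    (al : 'Z_m.+2 -> V) (i j : 'Z_m.+2) : V :=
  if (j < m.+1)%N then \sum_(k < i) y k j
  else al i - \sum_(l < m.+1) \sum_(k < i) y k l.

(** On the antidiagonal c, the last row is met at j = c + 1, because n - 1 = - 1,
    and be (c + 1) is the only nontrivial SE weight. The last row of NE weights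
    is thus what makes the south zig-zag of index c = i + j equal to ga c. *)
Definition normal_ne (V : zmodType) (m : nat) (y : nat -> nat -> V)
    (al be ga : 'Z_m.+2 -> V) (i j : 'Z_m.+2) : V :=
  if (i < m.+1)%N then normal_top y al i j
  else be (i + j + 1) - ga (i + j) -
       \sum_(r : 'Z_m.+2 | (r < m.+1)%N) normal_top y al r (i + j - r).

Definition normal_se (V : zmodType) (m : nat) (be : 'Z_m.+2 -> V)
    (i j : 'Z_m.+2) : V :=
  if (i < m.+1)%N then 0 else be j.

Lemma sum_Zn_max (V : zmodType) (m : nat) (F : 'Z_m.+2 -> V) :
  \sum_(i : 'Z_m.+2) F i = \sum_(i : 'Z_m.+2 | (i < m.+1)%N) F i + F ord_max.
Proof.
rewrite (bigD1 ord_max) //= addrC; congr (_ + _); apply: eq_bigl => i.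
by rewrite ltn_neqAle -ltnS ltn_ord andbT.
Qed.

Lemma Zn_max (m : nat) : ord_max = - 1 :> 'Z_m.+2.
Proof. by apply/eqP; rewrite -addr_eq0 Zn_max_succ. Qed.

Lemma normal_ne_row (V : zmodType) (m : nat) (y : nat -> nat -> V)
    (al be ga : 'Z_m.+2 -> V) (i : 'Z_m.+2) : (i < m.+1)%N ->
  \sum_j normal_ne y al be ga i j = al i.
Proof.
move=> hi; rewrite /normal_ne hi big_ord_recr /= [X in _ + X]/normal_top /= ltnn.
rewrite addrC -[RHS](subrK (\sum_(l < m.+1) \sum_(k < i) y k l)); congr (_ + _).
by apply: eq_bigr => j _; rewrite /normal_top /= ltn_ord.
Qed.

Lemma normal_se_col (V : zmodType) (m : nat) (be : 'Z_m.+2 -> V) (j : 'Z_m.+2) :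
  \sum_i normal_se be i j = be j.
Proof.
rewrite sum_Zn_max big1 ?add0r => [|i hi]; last by rewrite /normal_se hi.
by rewrite /normal_se /= ltnn.
Qed.

Lemma normal_diagonal (V : zmodType) (m : nat) (y : nat -> nat -> V)
    (al be ga : 'Z_m.+2 -> V) (k : 'Z_m.+2) :
  \sum_i (normal_se be i (k - i) - normal_ne y al be ga i (k - i)) = ga k.
Proof.
rewrite sumrB !sum_Zn_max big1 ?add0r => [|i hi]; last by rewrite /normal_se hi.
have -> : normal_se be ord_max (k - ord_max) = be (k + 1).
  by rewrite /normal_se /= ltnn Zn_max opprK.
rewrite {2}/normal_ne /= ltnn [_ + (k - _)]addrC subrK.
rewrite (eq_bigr (fun r => normal_top y al r (k - r))) => [|i hi].
  by rewrite [X in _ - X]addrC subrK subKr.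
by rewrite /normal_ne hi.
Qed.

Lemma normal_ne_face (V : zmodType) (m : nat) (y : nat -> nat -> V)
    (al be ga : 'Z_m.+2 -> V) (i j : 'Z_m.+2) : (i < m)%N -> (j < m.+1)%N ->
  normal_ne y al be ga (i + 1) j = normal_ne y al be ga i j + y i j.
Proof.
move=> hi hj; have hi1 : (i < m.+1)%N by apply: ltnW.
rewrite /normal_ne val_Zn_succ // ltnS hi hi1 /normal_top hj.
by rewrite val_Zn_succ // big_ord_recr.
Qed.

(** * Laurent monomials and their exponents *)

Lemma laurent_monomial0 (R : realType) (n : nat) (Y : 'M[R]_(n - 2, n - 1))
    (alpha beta gamma : 'I_n -> R) :
  laurent_monomial Y alpha beta gamma 0 = 1.
Proof.
rewrite /laurent_monomial /= !big1 ?mulr1 // => i _; rewrite ?ffunE ?expr0z //.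
by rewrite big1 // => j _; rewrite mxE expr0z.
Qed.

Lemma laurent_monomialD (R : realType) (n : nat) (Y : 'M[R]_(n - 2, n - 1))
    (alpha beta gamma : 'I_n -> R) (e f : laurent_exponent n) :
  (forall i j, Y i j != 0) ->
  (forall k, [/\ alpha k != 0, beta k != 0 & gamma k != 0]) ->
  laurent_monomial Y alpha beta gamma (e + f) =
  laurent_monomial Y alpha beta gamma e * laurent_monomial Y alpha beta gamma f.
Proof.
move=> Y0 z0; case: e f => [[[eY ea] eb] eg] [[[fY fa] fb] fg].
have prodD (x : 'I_n -> R) (u v : {ffun 'I_n -> int}) : (forall k, x k != 0) ->
    \prod_k x k ^ (u + v) k = (\prod_k x k ^ u k) * (\prod_k x k ^ v k).
  by move=> x0; rewrite -big_split; apply: eq_bigr => k _; rewrite ffunE expfzDr.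
have g0 k : (-1) ^+ n.+1 * gamma k != 0.
  by rewrite mulf_neq0 ?signr_eq0 //; case: (z0 k).
rewrite /laurent_monomial /= !prodD => // [|k|k]; try by case: (z0 k).
have -> : \prod_i \prod_j Y i j ^ (eY + fY) i j =
    (\prod_i \prod_j Y i j ^ eY i j) * (\prod_i \prod_j Y i j ^ fY i j).
  rewrite -big_split; apply: eq_bigr => i _; rewrite -big_split.
  by apply: eq_bigr => j _; rewrite mxE expfzDr.
by ring.
Qed.

(** Under the sign conditions of the theorem, (-1)^(n+1) gamma_k is positive. *)
Definition positive_data (R : realType) (n : nat) (Y : 'M[R]_(n - 2, n - 1))
    (alpha beta gamma : 'I_n -> R) : Prop :=
  (forall i j, 0 < Y i j) /\
  (forall k, [/\ 0 < alpha k, 0 < beta k & 0 < (-1) ^+ n.+1 * gamma k]).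

Lemma positive_data_neq0 (R : realType) (n : nat) (Y : 'M[R]_(n - 2, n - 1))
    (alpha beta gamma : 'I_n -> R) :
  positive_data Y alpha beta gamma ->
  (forall i j, Y i j != 0) /\
  (forall k, [/\ alpha k != 0, beta k != 0 & gamma k != 0]).
Proof.
move=> [Y0 z0]; split=> [i j|k]; first exact: lt0r_neq0.
have [a0 b0 /lt0r_neq0] := z0 k; rewrite mulf_eq0 => /norP[_ g0].
by split=> //; apply: lt0r_neq0.
Qed.

Lemma laurent_monomial_gt0 (R : realType) (n : nat) (Y : 'M[R]_(n - 2, n - 1))
    (alpha beta gamma : 'I_n -> R) (e : laurent_exponent n) :
  positive_data Y alpha beta gamma -> 0 < laurent_monomial Y alpha beta gamma e.
Proof.
move=> [Y0 z0]; case: e => [[[eY ea] eb] eg] /=.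
rewrite !mulr_gt0 // ?prodr_gt0 // => i _; last 3 first.
- by apply: exprz_gt0; case: (z0 i).
- by apply: exprz_gt0; case: (z0 i).
- by apply: exprz_gt0; case: (z0 i).
by apply: prodr_gt0 => j _; apply: exprz_gt0.
Qed.

Lemma laurent_monomialN (R : realType) (n : nat) (Y : 'M[R]_(n - 2, n - 1))
    (alpha beta gamma : 'I_n -> R) (e : laurent_exponent n) :
  positive_data Y alpha beta gamma ->
  laurent_monomial Y alpha beta gamma (- e) =
  (laurent_monomial Y alpha beta gamma e)^-1.
Proof.
move=> pos; have [Y0 z0] := positive_data_neq0 pos.
apply: (mulfI (lt0r_neq0 (laurent_monomial_gt0 e pos))).
rewrite -laurent_monomialD // subrr laurent_monomial0 divff //.
exact/lt0r_neq0/laurent_monomial_gt0.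
Qed.

(** Turns the additive identities of the normal form into identities between
    weights. *)
Lemma laurent_monomial_sum (R : realType) (n : nat) (Y : 'M[R]_(n - 2, n - 1))
    (alpha beta gamma : 'I_n -> R) (I : finType) (P : pred I)
    (e : I -> laurent_exponent n) :
  positive_data Y alpha beta gamma ->
  laurent_monomial Y alpha beta gamma (\sum_(i | P i) e i) =
  \prod_(i | P i) laurent_monomial Y alpha beta gamma (e i).
Proof.
move=> /positive_data_neq0[Y0 z0]; apply: big_morph; last exact: laurent_monomial0.
by move=> u v; apply: laurent_monomialD.
Qed.

Definition exp_Y (n i j : nat) : laurent_exponent n :=
  (\matrix_(k, l) Posz ((k == i :> nat) && (l == j :> nat)), 0, 0, 0).

Definition exp_alpha (n k : nat) : laurent_exponent n :=
  (0, [ffun l : 'I_n => Posz (l == k :> nat)], 0, 0).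

Definition exp_beta (n k : nat) : laurent_exponent n :=
  (0, 0, [ffun l : 'I_n => Posz (l == k :> nat)], 0).

Definition exp_gamma (n k : nat) : laurent_exponent n :=
  (0, 0, 0, [ffun l : 'I_n => Posz (l == k :> nat)]).

Lemma prod_delta_exp (F : fieldType) (n : nat) (x : 'I_n -> F) (k : 'I_n) :
  \prod_l x l ^ Posz (l == k :> nat) = x k.
Proof.
rewrite (bigD1 k) //= eqxx expr1z big1 ?mulr1 // => l /negPf lk.
by rewrite val_eqE lk expr0z.
Qed.

Lemma prod_exp0 (F : fieldType) (n : nat) (x : 'I_n -> F) :
  \prod_l x l ^ (0 : {ffun 'I_n -> int}) l = 1.
Proof. by rewrite big1 // => l _; rewrite ffunE expr0z. Qed.

Lemma prod_delta_ffun (F : fieldType) (n : nat) (x : 'I_n -> F) (k : 'I_n) :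
  \prod_l x l ^ [ffun l : 'I_n => Posz (l == k :> nat)] l = x k.
Proof. by rewrite -[RHS]prod_delta_exp; apply: eq_bigr => l _; rewrite ffunE. Qed.

Lemma prod_mx_exp0 (F : fieldType) (p q : nat) (x : 'M[F]_(p, q)) :
  \prod_i \prod_j x i j ^ (0 : 'M[int]_(p, q)) i j = 1.
Proof. by rewrite big1 // => i _; rewrite big1 // => j _; rewrite mxE expr0z. Qed.

Lemma laurent_monomial_Y (R : realType) (n : nat) (Y : 'M[R]_(n - 2, n - 1))
    (alpha beta gamma : 'I_n -> R) (i : 'I_(n - 2)) (j : 'I_(n - 1)) :
  laurent_monomial Y alpha beta gamma (exp_Y n i j) = Y i j.
Proof.
rewrite /laurent_monomial /= !prod_exp0 !mulr1.
rewrite (bigD1 i) //= [X in _ * X]big1 ?mulr1 => [|k /negPf ki].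
  rewrite -[RHS](prod_delta_exp (Y i)); apply: eq_bigr => l _.
  by rewrite mxE eqxx.
by rewrite big1 // => l _; rewrite mxE val_eqE ki expr0z.
Qed.

Lemma laurent_monomial_alpha (R : realType) (n : nat)
    (Y : 'M[R]_(n - 2, n - 1)) (alpha beta gamma : 'I_n -> R) (k : 'I_n) :
  laurent_monomial Y alpha beta gamma (exp_alpha n k) = alpha k.
Proof.
rewrite /laurent_monomial /= prod_mx_exp0 !prod_exp0 prod_delta_ffun.
by rewrite !mulr1 mul1r.
Qed.

Lemma laurent_monomial_beta (R : realType) (n : nat)
    (Y : 'M[R]_(n - 2, n - 1)) (alpha beta gamma : 'I_n -> R) (k : 'I_n) :
  laurent_monomial Y alpha beta gamma (exp_beta n k) = beta k.
Proof.
rewrite /laurent_monomial /= prod_mx_exp0 !prod_exp0 prod_delta_ffun.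
by rewrite !mulr1 !mul1r.
Qed.

Lemma laurent_monomial_gamma (R : realType) (n : nat)
    (Y : 'M[R]_(n - 2, n - 1)) (alpha beta gamma : 'I_n -> R) (k : 'I_n) :
  laurent_monomial Y alpha beta gamma (exp_gamma n k) = (-1) ^+ n.+1 * gamma k.
Proof.
rewrite /laurent_monomial /= prod_mx_exp0 !prod_exp0 !mul1r.
exact: (prod_delta_ffun (fun k => (-1) ^+ n.+1 * gamma k)).
Qed.

Definition normal_ne_exp (m : nat) (i j : 'Z_m.+2) : laurent_exponent m.+2 :=
  normal_ne (exp_Y m.+2) (exp_alpha m.+2) (exp_beta m.+2) (exp_gamma m.+2) i j.

Definition normal_se_exp (m : nat) (i j : 'Z_m.+2) : laurent_exponent m.+2 :=
  normal_se (exp_beta m.+2) i j.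

(** * Connections with positive real weights *)

Lemma real_complex_neq0 (R : realType) (x : R) : 0 < x -> x%:C != 0.
Proof. by move=> x0; rewrite fmorph_eq0 lt0r_neq0. Qed.

Definition real_connection (R : realType) (n : nat) (a b : 'Z_n -> 'Z_n -> R)
    (a0 : forall i j, 0 < a i j) (b0 : forall i j, 0 < b i j) : connection R n :=
  @Connection R n (fun _ _ => 1) (fun i j => (a i j)%:C) (fun i j => (b i j)%:C)
    (fun _ _ => oner_neq0 _) (fun i j => real_complex_neq0 (a0 i j))
    (fun i j => real_complex_neq0 (b0 i j)).

Lemma face_weight_real (R : realType) (n : nat) (a b : 'Z_n -> 'Z_n -> R)
    (a0 : forall i j, 0 < a i j) (b0 : forall i j, 0 < b i j) (i j : 'Z_n) :
  face_weight (real_connection a0 b0) i j =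
  (b i j * a (i + 1) j / b i (j + 1) / a i j)%:C.
Proof. by rewrite !rmorphM !fmorphV /= /face_weight /= invr1 !mulr1. Qed.

Lemma zigzagNE_real (R : realType) (n : nat) (a b : 'Z_n -> 'Z_n -> R)
    (a0 : forall i j, 0 < a i j) (b0 : forall i j, 0 < b i j) (i : 'Z_n) :
  zigzagNE (real_connection a0 b0) i = (\prod_j a i j)%:C.
Proof. by rewrite rmorph_prod; apply: eq_bigr => j _; rewrite /= divr1. Qed.

Lemma zigzagSE_real (R : realType) (n : nat) (a b : 'Z_n -> 'Z_n -> R)
    (a0 : forall i j, 0 < a i j) (b0 : forall i j, 0 < b i j) (j : 'Z_n) :
  zigzagSE (real_connection a0 b0) j = (\prod_i b i j)%:C.
Proof. by rewrite rmorph_prod; apply: eq_bigr => i _; rewrite /= divr1. Qed.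

Lemma zigzagS_real (R : realType) (n : nat) (a b : 'Z_n -> 'Z_n -> R)
    (a0 : forall i j, 0 < a i j) (b0 : forall i j, 0 < b i j) (k : 'Z_n) :
  zigzagS (real_connection a0 b0) k =
  (\prod_i \prod_(j | i + j == k) (b i j / a i j))%:C.
Proof.
rewrite rmorph_prod; apply: eq_bigr => i _; rewrite rmorph_prod.
by apply: eq_bigr => j _; rewrite /= rmorphM fmorphV.
Qed.

(** * The connection with given coordinates *)

Definition monomial_connection (R : realType) (m : nat)
    (Y : 'M[R]_(m.+2 - 2, m.+2 - 1)) (alpha beta gamma : 'I_m.+2 -> R)
    (pos : positive_data Y alpha beta gamma) : connection R m.+2 :=
  real_connection (fun i j => laurent_monomial_gt0 (normal_ne_exp i j) pos)
                  (fun i j => laurent_monomial_gt0 (normal_se_exp i j) pos).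

Lemma prod_signed_gamma (R : realType) (m : nat) (gamma : 'I_m.+2 -> R) :
  \prod_k ((-1) ^+ m.+3 * gamma k) = \prod_k gamma k.
Proof.
rewrite big_split /= prodr_const card_ord -exprM -signr_odd oddM /=.
by case: (odd m); rewrite mul1r.
Qed.

Lemma real_complex_gt0 (R : realType) (x : R) : (0 < x%:C) = (0 < x).
Proof. by rewrite -[RHS]ltcR. Qed.

(** The last row product is the only prescribed value that is not built into
    the normal form; it follows from the others and from the relation between
    the products of alpha, beta and gamma. *)
Lemma monomial_connection_prescribed (R : realType) (m : nat)
    (Y : 'M[R]_(m.+2 - 2, m.+2 - 1)) (alpha beta gamma : 'I_m.+2 -> R)
    (pos : positive_data Y alpha beta gamma) :
  \prod_k (alpha k * gamma k) = \prod_k beta k ->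
  positive_prescribed alpha beta gamma (monomial_connection pos).
Proof.
move=> prodE; pose mon := laurent_monomial Y alpha beta gamma.
pose a (i j : 'Z_m.+2) := mon (normal_ne_exp i j).
pose b (i j : 'Z_m.+2) := mon (normal_se_exp i j).
have a0 i j : 0 < a i j by apply: laurent_monomial_gt0.
have b0 i j : 0 < b i j by apply: laurent_monomial_gt0.
have [Y0 z0] := pos; have [Yn zn] := positive_data_neq0 pos.
have diag (k : 'Z_m.+2) :
    \prod_i \prod_(j | i + j == k) (b i j / a i j) = (-1) ^+ m.+3 * gamma k.
  rewrite prod_antidiagonal -(laurent_monomial_gamma Y alpha beta gamma k).
  rewrite -[exp_gamma _ _](normal_diagonal (exp_Y m.+2) (exp_alpha m.+2)
    (exp_beta m.+2) (exp_gamma m.+2) k).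
  rewrite laurent_monomial_sum //; apply: eq_bigr => i _.
  by rewrite laurent_monomialD // laurent_monomialN.
have col (j : 'Z_m.+2) : \prod_i b i j = beta j.
  rewrite -(laurent_monomial_beta Y alpha beta gamma j).
  rewrite -[exp_beta _ _](normal_se_col (exp_beta m.+2) j).
  by rewrite laurent_monomial_sum.
have row (i : 'Z_m.+2) : \prod_j a i j = alpha i.
  have alpha0 k : alpha k != 0 by case: (zn k).
  suff : forall i : 'Z_m.+2, \prod_j a i j / alpha i = 1.
    by move/(_ i)/(canRL (divfK (alpha0 i))); rewrite mul1r.
  apply: prod_eq1_max => [|k hk].
    rewrite prodf_div.
    have prod_alpha0 : \prod_(k : 'Z_m.+2) alpha k != 0 by apply/prodf_neq0.
    suff -> : \prod_k \prod_j a k j = \prod_(k : 'Z_m.+2) alpha k by rewrite divff.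
    have prod_gamma0 : \prod_(k : 'Z_m.+2) gamma k != 0.
      by apply/prodf_neq0 => k _; case: (zn k).
    have prodZ : \prod_(k : 'Z_m.+2) alpha k * \prod_(k : 'Z_m.+2) gamma k =
      \prod_(k : 'Z_m.+2) beta k by rewrite -big_split; apply: prodE.
    have gammaZ : \prod_(k : 'Z_m.+2) ((-1) ^+ m.+3 * gamma k) =
      \prod_(k : 'Z_m.+2) gamma k := prod_signed_gamma gamma.
    apply: (mulIf prod_gamma0); rewrite prodZ -gammaZ.
    rewrite -(eq_bigr _ (fun k _ => diag k)).
    rewrite (prod_all_antidiagonals (fun i j => b i j / a i j)).
    rewrite -big_split -(eq_bigr _ (fun j _ => col j)) [RHS]exchange_big /=.
    apply: eq_bigr => r _; rewrite -big_split; apply: eq_bigr => s _ /=.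
    by rewrite mulrC divfK // lt0r_neq0.
  rewrite -(laurent_monomial_alpha Y alpha beta gamma k).
  rewrite -[exp_alpha _ _](normal_ne_row (exp_Y m.+2) (exp_alpha m.+2)
    (exp_beta m.+2) (exp_gamma m.+2) hk).
  rewrite laurent_monomial_sum // divff //; apply/prodf_neq0 => j _.
  exact: lt0r_neq0.
split=> [i j|k].
  rewrite face_weight_real real_complex_gt0.
  by rewrite !(divr_gt0, mulr_gt0) // laurent_monomial_gt0.
rewrite natr_Zp; split.
- by rewrite zigzagNE_real -row.
- by rewrite zigzagSE_real -col.
- by rewrite zigzagS_real -diag.
Qed.

Lemma monomial_connection_faces (R : realType) (m : nat)
    (Y : 'M[R]_(m.+2 - 2, m.+2 - 1)) (alpha beta gamma : 'I_m.+2 -> R)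
    (pos : positive_data Y alpha beta gamma) :
  face_coordinates Y (monomial_connection pos).
Proof.
move=> i j; rewrite face_weight_real; congr (_%:C).
have [Yn zn] := positive_data_neq0 pos.
have hi : (i < m)%N by have := ltn_ord i; lia.
have hj : (j < m.+1)%N by have := ltn_ord j; lia.
have vi : (i%:R : 'Z_m.+2) = i :> nat.
  by rewrite val_Zp_nat // modn_small //; lia.
have vj : (j%:R : 'Z_m.+2) = j :> nat.
  by rewrite val_Zp_nat // modn_small //; lia.
have se0 (l : 'Z_m.+2) : normal_se_exp i%:R l = 0.
  by rewrite /normal_se_exp /normal_se vi ltnW.
rewrite !se0 !laurent_monomial0 mul1r divr1 [normal_ne_exp (_ + 1) _]normal_ne_face
  ?vi ?vj // laurent_monomialD // mulrAC divff ?mul1r ?laurent_monomial_Y //.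
exact/lt0r_neq0/laurent_monomial_gt0.
Qed.

Lemma prescribed_gauge_equiv (R : realType) (m : nat)
    (Y : 'M[R]_(m.+2 - 2, m.+2 - 1)) (alpha beta gamma : 'I_m.+2 -> R)
    (c c' : connection R m.+2) :
  positive_prescribed alpha beta gamma c -> face_coordinates Y c ->
  positive_prescribed alpha beta gamma c' -> face_coordinates Y c' ->
  gauge_equiv c c'.
Proof.
move=> [_ zz] fY [_ zz'] fY'; apply: same_data_gauge_equiv.
- by move=> k; have [+ _ _] := zz k; have [+ _ _] := zz' k; rewrite natr_Zp => -> ->.
- by move=> k; have [_ + _] := zz k; have [_ + _] := zz' k; rewrite natr_Zp => -> ->.
- by move=> k; have [_ _ +] := zz k; have [_ _ +] := zz' k; rewrite natr_Zp => -> ->.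
move=> i j hi hj.
have hi' : (i < m.+2 - 2)%N by lia.
have hj' : (j < m.+2 - 1)%N by lia.
have := fY (Ordinal hi') (Ordinal hj'); have := fY' (Ordinal hi') (Ordinal hj').
by rewrite /= !natr_Zp => -> ->.
Qed.

Lemma positive_connection_data (R : realType) (m : nat)
    (alpha beta gamma : 'I_m.+2 -> R) (c : connection R m.+2) :
  positive_prescribed alpha beta gamma c ->
  exists2 Y : 'M[R]_(m.+2 - 2, m.+2 - 1),
    positive_entries Y & face_coordinates Y c.
Proof.
move=> [X0 _].
have XE i j : face_weight c i j = (complex.Re (face_weight c i j))%:C.
  have := X0 i j; rewrite ltcE => /andP[/eqP].
  by case: (face_weight c i j) => x y /= ->.
exists (\matrix_(i, j) complex.Re (face_weight c i%:R j%:R)) => i j.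
  by rewrite mxE -real_complex_gt0 -XE.
by rewrite mxE -XE.
Qed.

(** The data of a positive connection satisfy the sign conditions and the
    product relation, so uniqueness identifies it with a monomial connection. *)
Lemma real_connection_monomial (R : realType) (m : nat)
    (a b : 'Z_m.+2 -> 'Z_m.+2 -> R)
    (a0 : forall i j, 0 < a i j) (b0 : forall i j, 0 < b i j) :
  exists Y alpha beta gamma,
    exists pos : @positive_data R m.+2 Y alpha beta gamma,
    gauge_equiv (real_connection a0 b0) (monomial_connection pos).
Proof.
pose c := real_connection a0 b0.
pose alpha (i : 'I_m.+2) := \prod_j a i j.
pose beta (j : 'I_m.+2) := \prod_i b i j.
pose g (k : 'Z_m.+2) := \prod_i \prod_(j | i + j == k) (b i j / a i j).
pose gamma (k : 'I_m.+2) := (-1) ^+ m.+3 * g k.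
have gammaK k : (-1) ^+ m.+3 * gamma k = g k.
  by rewrite /gamma mulrA -expr2 sqrr_sign mul1r.
have presc : positive_prescribed alpha beta gamma c.
  split=> [i j|k].
    rewrite face_weight_real real_complex_gt0.
    by rewrite !(divr_gt0, mulr_gt0).
  by rewrite natr_Zp gammaK zigzagNE_real zigzagSE_real zigzagS_real.
have [Y Y0 fY] := positive_connection_data presc.
have pos : positive_data Y alpha beta gamma.
  split=> // k; rewrite gammaK; split; apply: prodr_gt0 => i _ //.
  by apply: prodr_gt0 => j _; apply: divr_gt0.
have prodE : \prod_k (alpha k * gamma k) = \prod_k beta k.
  rewrite big_split /= -[X in _ * X]prod_signed_gamma.
  rewrite (eq_bigr _ (fun k _ => gammaK k)) /g.
  rewrite (prod_all_antidiagonals (fun i j => b i j / a i j)).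
  rewrite -big_split [RHS]exchange_big /=; apply: eq_bigr => i _.
  rewrite -big_split; apply: eq_bigr => j _ /=.
  by rewrite mulrC divfK // lt0r_neq0.
exists Y, alpha, beta, gamma, pos; apply: (prescribed_gauge_equiv presc fY).
  exact: monomial_connection_prescribed.
exact: monomial_connection_faces.
Qed.

(** * Distinct paths have distinct exponents *)

Fixpoint path_exponent (m : nat) (i j : nat) (s : seq bool) :
    laurent_exponent m.+2 :=
  match s with
  | [::] => 0
  | true :: s' => normal_se_exp i%:R j%:R + path_exponent m i.+1 j s'
  | false :: s' => normal_ne_exp i%:R j%:R + path_exponent m i j.+1 s'
  end.

Lemma path_weight_monomial (R : realType) (m : nat)
    (Y : 'M[R]_(m.+2 - 2, m.+2 - 1)) (alpha beta gamma : 'I_m.+2 -> R)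
    (pos : positive_data Y alpha beta gamma) (i j : nat) (s : seq bool) :
  path_weight (monomial_connection pos) i j s =
  (laurent_monomial Y alpha beta gamma (path_exponent m i j s))%:C.
Proof.
have [Y0 z0] := positive_data_neq0 pos.
elim: s i j => [|[] s IHs] i j.
- by rewrite [path_exponent _ _ _ _]/= laurent_monomial0.
- by rewrite [path_exponent _ _ _ _]/= laurent_monomialD // rmorphM /= -IHs.
- by rewrite [path_exponent _ _ _ _]/= laurent_monomialD // rmorphM /= -IHs.
Qed.

Definition marked_weight (R : realType) (n : nat) (p q i j : 'Z_n) : R :=
  if (i == p) && (j == q) then 2%:R else 1.

Lemma marked_weight_gt0 (R : realType) (n : nat) (p q i j : 'Z_n) :
  0 < marked_weight R p q i j.
Proof. by rewrite /marked_weight; case: ifP. Qed.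

Definition marked_connection (R : realType) (n : nat) (p q : 'Z_n) :
    connection R n :=
  real_connection (fun _ _ => ltr01) (marked_weight_gt0 R p q).

Lemma natr_Zn_inj (m p i : nat) : (p <= i < p + m.+2)%N ->
  i%:R = p%:R :> 'Z_m.+2 -> i = p.
Proof.
move=> /andP[lepi ltip] /(congr1 val); rewrite /= !val_Zp_nat // => /eqP.
rewrite eqn_mod_dvd // => dvd; case: (posnP (i - p)) => [|i0]; first lia.
by move: lepi ltip (dvdn_leq i0 dvd); clear; lia.
Qed.

(** A path that has left (p, q) and stays within n steps of it does not meet
    (p, q) again modulo n before its last vertex. *)
Lemma marked_path_past (R : realType) (m p q i j : nat) (s : seq bool) :
  (p <= i)%N -> (q <= j)%N -> (p + q < i + j)%N ->
  (i + j + size s <= p + q + m.+2)%N ->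
  path_weight (marked_connection R (p%:R : 'Z_m.+2) q%:R) i j s = 1.
Proof.
elim: s i j => [|[] s IHs] i j //= hi hj hij hs.
  rewrite IHs ?mulr1; try lia.
  rewrite /marked_weight; case: ifP => // /andP[/eqP ei /eqP ej].
  have := natr_Zn_inj _ ei; have := natr_Zn_inj _ ej; lia.
by rewrite IHs ?mulr1 //; lia.
Qed.

(** The marked edge is the SE edge at the first position where the paths
    separate. *)
Lemma marked_paths_differ (R : realType) (m i j : nat) (s t : seq bool) :
  size s = size t -> (size s <= m.+2)%N -> s != t ->
  exists p q : 'Z_m.+2, path_weight (marked_connection R p q) i j s !=
                        path_weight (marked_connection R p q) i j t.
Proof.
have first_step (i' j' : nat) s' t' : (size s' < m.+2)%N -> (size t' < m.+2)%N ->
  let c := marked_connection R (i'%:R : 'Z_m.+2) j'%:R in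
  path_weight c i' j' (true :: s') != path_weight c i' j' (false :: t').
  move=> hs ht /=; rewrite !marked_path_past; try lia.
  rewrite /marked_weight !eqxx /= !mulr1 -subr_eq0 -rmorphB /=.
  by rewrite -[2%:R]/(1 + 1) addrK oner_neq0.
elim: s t i j => [|x s IHs] [|y t] i j //= [est] hs.
rewrite eqseq_cons negb_and; case: (eqVneq x y) => [<- /= st|xy _]; last first.
  exists i%:R, j%:R; case: x y xy => [] [] // _.
    by apply: first_step; rewrite -?est.
  by rewrite eq_sym; apply: first_step; rewrite -?est.
case: x.
  have [p [q hpq]] := IHs t i.+1 j est (ltnW hs) st; exists p, q.
  apply: contra hpq => /eqP /(mulfI (se_neq0 (marked_connection R p q) i%:R j%:R)) e.
  exact/eqP.
have [p [q hpq]] := IHs t i j.+1 est (ltnW hs) st; exists p, q.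
apply: contra hpq => /eqP /(mulfI (ne_neq0 (marked_connection R p q) i%:R j%:R)) e.
exact/eqP.
Qed.

(** Equal exponents would give equal weights in all monomial connections, hence
    in every connection with horizontal weights 1 and positive weights, up to a
    gauge factor that depends only on the common ends; marked_paths_differ
    excludes this. *)
Lemma path_exponent_inj (R : realType) (m i j : nat) (s t : seq bool) :
  size s = size t -> (size s <= m.+2)%N ->
  path_end i j s = path_end i j t ->
  path_exponent m i j s = path_exponent m i j t -> s = t.
Proof.
move=> est hs eend eexp; apply/eqP; apply: contraT => st.
have [p [q]] := marked_paths_differ R i j est hs st.
have [Y [alpha [beta [gamma [pos geq]]]]] :=
  real_connection_monomial (fun _ _ => ltr01) (marked_weight_gt0 R p q).
have hor1 : horizontal1 (marked_connection R p q) by [].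
have hor1' : horizontal1 (monomial_connection pos) by [].
have [g g0 gE] := gauge_horizontal1 hor1 hor1' geq.
case/eqP; apply/eqP.
have := path_weight_monomial pos i j s; rewrite eexp -path_weight_monomial.
rewrite !(path_weight_gauge g0 gE) eend => /mulfI -> //.
by rewrite mulf_neq0 ?invr_eq0.
Qed.

Definition path_exponents (m i j : nat) (P : pred (nat * nat)) :
    seq (laurent_exponent m.+2) :=
  [seq path_exponent m i j s |
     s : m.+2.-tuple bool <- enum {: m.+2.-tuple bool} & P (path_end i j s)].

(** All these paths end on one antidiagonal, where the hypothesis on P leaves a
    single end. *)
Lemma path_exponents_uniq (R : realType) (m i j : nat) (P : pred (nat * nat)) :
  (forall u v, P u -> P v -> (u.1 + u.2 = v.1 + v.2)%N -> u = v) ->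
  uniq (path_exponents m i j P).
Proof.
move=> P1; rewrite map_inj_in_uniq => [|s t]; first exact/filter_uniq/enum_uniq.
rewrite !mem_filter => /andP[Ps _] /andP[Pt _] est; apply: val_inj.
apply: (path_exponent_inj R) est; rewrite ?size_tuple //.
by apply: P1 => //; rewrite !path_end_antidiagonal !size_tuple.
Qed.

Lemma laurent_sum_path_exponents (R : realType) (m : nat)
    (Y : 'M[R]_(m.+2 - 2, m.+2 - 1)) (alpha beta gamma : 'I_m.+2 -> R)
    (pos : positive_data Y alpha beta gamma) (i j : nat) (P : pred (nat * nat)) :
  (laurent_sum Y alpha beta gamma (path_exponents m i j P))%:C =
  \sum_(s : m.+2.-tuple bool | P (path_end i j s))
     path_weight (monomial_connection pos) i j s.
Proof.
rewrite /laurent_sum big_map big_filter big_enum_cond rmorph_sum /=.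
by apply: eq_bigr => s _; rewrite path_weight_monomial.
Qed.

(** * The parameterization *)

Theorem mainTheorem3 (R : realType) (n : nat) (hn : (2 <= n)%N) :
  (* exponents of the Laurent polynomials: they depend only on n *)
  exists LA LB : 'I_n -> 'I_n -> seq (laurent_exponent n),
  (forall i' i, uniq (LA i' i) /\ uniq (LB i' i)) /\
  forall alpha beta gamma : 'I_n -> R,
  (forall k, [/\ alpha k != 0, beta k != 0 & gamma k != 0]) ->
  \prod_k (alpha k * gamma k) = \prod_k beta k ->
  (odd n /\ (forall k, [/\ 0 < alpha k, 0 < beta k & 0 < gamma k])) \/
  (~~ odd n /\ (forall k, [/\ 0 < alpha k, 0 < beta k & gamma k < 0])) ->
  [/\ OmegaPlus alpha beta gamma `<=`
        Omega (fun k => (alpha k)%:C) (fun k => (beta k)%:C)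
              (fun k => (gamma k)%:C),
      forall Y : 'M[R]_(n - 2, n - 1), positive_entries Y ->
        (exists c : connection R n,
           positive_prescribed alpha beta gamma c /\ face_coordinates Y c) /\
        (forall c c' : connection R n,
           positive_prescribed alpha beta gamma c -> face_coordinates Y c ->
           positive_prescribed alpha beta gamma c' -> face_coordinates Y c' ->
           gauge_equiv c c')
    & exists Psi : 'M[R]_(n - 2, n - 1) -> set ('M[R[i]]_n * 'M[R[i]]_n),
      [/\ forall (Y : 'M[R]_(n - 2, n - 1)) (c : connection R n),
            positive_entries Y -> horizontal1 c ->
            positive_prescribed alpha beta gamma c -> face_coordinates Y c ->
            Psi Y = conj_class (matA c) (matB c),
          set_fun (@positive_entries R (n - 2) (n - 1))
            (OmegaPlus alpha beta gamma) Psi,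
          set_surj (@positive_entries R (n - 2) (n - 1))
            (OmegaPlus alpha beta gamma) Psi
        & forall Y : 'M[R]_(n - 2, n - 1), positive_entries Y ->
            exists c : connection R n,
            [/\ horizontal1 c, positive_prescribed alpha beta gamma c,
                face_coordinates Y c
              & forall i' i,
                  matA c i' i =
                    (laurent_sum Y alpha beta gamma (LA i' i))%:C /\
                  matB c i' i =
                    (laurent_sum Y alpha beta gamma (LB i' i))%:C]]].
Proof.
case: n hn => [|[|m]] // _.
pose LA (i' i : 'I_m.+2) :=
  path_exponents m i (m.+2 - 1 - i) (fun e => e.1 == i' :> nat).
pose LB (i' i : 'I_m.+2) :=
  path_exponents m i (m.+2 - 1 - i) (fun e => e.2 == (m.+2 - 1 - i')%N).
exists LA, LB; split=> [i' i|alpha beta gamma _ prodE signs].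
  split; apply: (path_exponents_uniq R) => -[u1 u2] [v1 v2] /= /eqP -> /eqP ->.
    by move/addnI ->.
  by move/addIn ->.
have pos (Y : 'M[R]_(m.+2 - 2, m.+2 - 1)) :
    positive_entries Y -> positive_data Y alpha beta gamma.
  move=> Y0; split=> // k; rewrite -signr_odd oddS.
  by case: signs => -[hodd /(_ k)[a0 b0 g0]]; split; rewrite // ?hodd ?(negPf hodd)
    /= ?mul1r ?mulN1r ?oppr_gt0.
have monomial (Y : 'M[R]_(m.+2 - 2, m.+2 - 1)) : positive_entries Y ->
    exists c : connection R m.+2,
    [/\ horizontal1 c, positive_prescribed alpha beta gamma c,
        face_coordinates Y c
      & forall i' i,
          matA c i' i = (laurent_sum Y alpha beta gamma (LA i' i))%:C /\
          matB c i' i = (laurent_sum Y alpha beta gamma (LB i' i))%:C].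
  move=> Y0; exists (monomial_connection (pos Y Y0)); split=> //.
  - exact: monomial_connection_prescribed.
  - exact: monomial_connection_faces.
  by move=> i' i; rewrite !mxE !(laurent_sum_path_exponents (pos Y Y0)).
split; first exact: OmegaPlus_sub_Omega.
  move=> Y Y0; split; last by move=> c c'; apply: prescribed_gauge_equiv.
  by have [c [_ presc fY _]] := monomial Y Y0; exists c.
(* Psi Y collects the pairs of all connections with the data of Y; by gauge
   invariance, each single one of them already gives the whole class. *)
pose Psi (Y : 'M[R]_(m.+2 - 2, m.+2 - 1)) : set ('M[R[i]]_m.+2 * 'M[R[i]]_m.+2) :=
  [set q | exists c : connection R m.+2,
     [/\ horizontal1 c, positive_prescribed alpha beta gamma c,
         face_coordinates Y c & conj_class (matA c) (matB c) q]].
have PsiE Y c : horizontal1 c -> positive_prescribed alpha beta gamma c ->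
    face_coordinates Y c -> Psi Y = conj_class (matA c) (matB c).
  move=> hor1 presc fY; apply/seteqP; split=> [q [c' [hor1' presc' fY' qc']]|q qc].
    have geq := prescribed_gauge_equiv presc fY presc' fY'.
    by rewrite -(conj_class_gauge hor1 hor1' geq).
  by exists c.
exists Psi; split=> [Y c _|Y Y0|w [c [hor1 presc ->]]|//].
- exact: PsiE.
- have [c [hor1 presc fY _]] := monomial Y Y0.
  by exists c; split=> //; apply: PsiE.
- have [Y Y0 fY] := positive_connection_data presc.
  by exists Y => //; apply: PsiE.
Qed.
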